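(* Let $\mathcal F$ be a class of binary predictors satisfying Axioms 1--4 and containing the predictors $\phi^0,\phi^1,\psi^1,\psi^2$ (all described in the context), with a fixed predictor hierarchy $\mathcal F_1\subset\mathcal F_2\subset\cdots$ on $\mathcal F$, and write $I(\cdot)=I(\cdot\,;\mathcal F)$. Let $a\in\{0,1\}^\infty$ be $\mathcal F$-independent. For $\nu=1,2$ define the sequence $b^\nu$ by $b^\nu_i=a_{3i+\nu-1}\oplus a_{3i+2}$ for $i\ge0$. Then for at least one $\nu\in\{1,2\}$, $$I(b^\nu)\ \ge\ I(a)\left(1+\frac{1-2I(a)}{5}\right).$$ Hence $I(b^\nu)>I(a)$ for at least one $\nu\in\{1,2\}$ whenever $0<I(a)<1/2$.
   Context: **Predictors.** $\{0,1\}^\infty$ is the set of infinite binary sequences $a=a_0a_1a_2\ldots$, and $\oplus$ is addition mod 2 (applied termwise to sequences). A binary predictor is a map $f:\{0,1\}^\infty\to\{0,1\}^\infty$ that is causal: $(f(a))_0$ is the same for all $a$, and for each $n\ge1$, if $a_i=b_i$ for $i=0,\dots,n-1$ then $(f(a))_n=(f(b))_n$. We write $fa$ for $f(a)$. **Hierarchy and predictability.** A predictor hierarchy on a class $\mathcal F$ of predictors is an increasing sequence of nonempty finite sets $\mathcal F_1\subset\mathcal F_2\subset\cdots$ with $\bigcup_i\mathcal F_i=\mathcal F$. The predictability (also called unpredictability) of $a$ is $$I(a;\mathcal F)=\lim_{m\to\infty}\limsup_{n\to\infty}\min_{f\in\mathcal F_m}\frac1n\sum_{i=0}^{n-1}\big((f(a))_i\oplus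 a_i\big).$$ **Operations.** $(P^0a)_i=a_{3i}$, $(P^1a)_i=a_{3i+2}$, $(P^2a)_i=a_{3i+1}$; $(S^1a)_i=a_{3i}\oplus a_{3i+2}$, $(S^2a)_i=a_{3i+1}\oplus a_{3i+2}$, for $i\ge0$. **Selected subsequence.** For a predictor $f$, $f_*a$ is the subsequence of $a$ consisting of those $a_i$ for which $(fa)_i=1$, in increasing order of $i$, indexed from $0$. **Independence.** $a$ is $\mathcal F$-independent (consists of $\mathcal F$-independent quantities) if $I(f_*a)=I(a)$ for any $f\in\mathcal F$ for which $f_*a$ is an infinite sequence (i.e. $(fa)_i=1$ for infinitely many $i$). **Axioms on $\mathcal F$.** Axiom 1 (Summation): for any $f^0,f^1\in\mathcal F$, the map $f$ with $(fa)_i=(f^0a)_i\oplus(f^1a)_i$ is in $\mathcal F$. Axiom 2 (Interleaving): for any $f^0,f^1,f^2\in\mathcal F$, the map $f$ determined by $P^\nu fa=P^\nu f^\nu a$ for all $a$ and $\nu=0,1,2$ is in $\mathcal F$. Axiom 3 (Subsequences): for any $f\in\mathcal F$, the class $\mathcal F$ contains at least one map of each of the following types (identities for all $a$): $f^1$ with $P^1f^1a=fS^1a$; $f^2$ with $P^1f^2a=fS^2a$; $g^1$ with $P^2g^1a=fS^1a$; $g^2$ with $P^2g^2a=fS^2a$; and, for each $\nu=0,1,2$, $h^\nu$ with $P^\nu h^\nu a=fP^\nu a$. Axiom 4 (Switching): for any $f^0,f^1,f^2\in\mathcal F$, the class $\mathcal F$ contains the map $f$ given by $(fa)_i=(f^1a)_i$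 if $(f^0a)_i=0$, and $(fa)_i=(f^2b)_{l(i)}$ if $(f^0a)_i=1$, where $b=f^0_*a$ and $l(i)$ is the number of indices $j<i$ with $(f^0a)_j=1$. (If $b$ is finite, $(f^2b)_{l(i)}$ is still well defined by causality, as it depends only on the first $l(i)$ terms of $b$.) **Simple predictors.** $\phi^0,\phi^1$ are the constant predictors $(\phi^0(a))_n=0$, $(\phi^1(a))_n=1$; and $(\psi^1a)_j=a_{j-2}$ for $j\ge2$, $(\psi^2a)_j=a_{j-1}$ for $j\ge1$, with some fixed values for the remaining initial indices $j$. *)

(* Defs.v *)
From mathcomp Require Import all_boot all_order all_algebra.
From mathcomp Require Import all_classical all_reals all_analysis.

Set Implicit Arguments.
Unset Strict Implicit.
Unset Printing Implicit Defensive.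

Import Order.TTheory GRing.Theory Num.Theory.
Import numFieldNormedType.Exports.

Local Open Scope classical_set_scope.
Local Open Scope ring_scope.

Definition binseq := nat -> bool.
Definition binmap := binseq -> binseq.

(* For n = 0 the premise is vacuous, so (f a)_0 is the same for all a. *)
Definition causal (f : binmap) : Prop :=
  forall (n : nat) (a b : binseq),
    (forall i : nat, (i < n)%N -> a i = b i) -> f a n = f b n.

(* Fs 0, Fs 1, Fs 2, ... are the sets F_1, F_2, F_3, ... of the hierarchy. *)
Definition hierarchy (F : set binmap) (Fs : nat -> set binmap) : Prop :=
  [/\ forall m, finite_set (Fs m),
      forall m, Fs m !=set0,
      forall m, Fs m `<=` Fs m.+1
    & \bigcup_m Fs m = F].

Definition error_rate (R : realType) (f : binmap) (a : binseq) (n : nat) : R :=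
  n%:R^-1 * \sum_(i < n) (f a i (+) a i)%:R.

(* For G finite and nonempty, inf is the minimum over f in G. *)
Definition min_error_rate (R : realType) (G : set binmap) (a : binseq)
    (n : nat) : R :=
  inf [set error_rate R f a n | f in G].

(* The error rates lie in [0, 1] and min_error_rate is nonincreasing in G, so
   for a hierarchy Fs the total operators limn_sup and limn are applied only
   to sequences for which they are the genuine limsup and limit. *)
Definition predictability (R : realType) (Fs : nat -> set binmap)
    (a : binseq) : R :=
  limn (fun m : nat => limn_sup (min_error_rate R (Fs m) a)).

(* P1 takes the residue 2 and P2 the residue 1 modulo 3. *)
Definition P0 (a : binseq) : binseq := fun i => a (3 * i)%N.
Definition P1 (a : binseq) : binseq := fun i => a (3 * i + 2)%N.
Definition P2 (a : binseq) : binseq := fun i => a (3 * i + 1)%N.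
Definition S1 (a : binseq) : binseq :=
  fun i => a (3 * i)%N (+) a (3 * i + 2)%N.
Definition S2 (a : binseq) : binseq :=
  fun i => a (3 * i + 1)%N (+) a (3 * i + 2)%N.

Definition selcount (f : binmap) (a : binseq) (i : nat) : nat :=
  (\sum_(j < i) f a j)%N.

(* Term k is a_i for the unique i with (f a)_i = 1 that is preceded by exactly
   k selected indices. If fewer than k + 1 indices are selected, get returns a
   default index and the value is junk; switch below only depends on genuine
   terms, since f2 is causal. *)
Definition select (f : binmap) (a : binseq) : binseq :=
  fun k => a (get [set i : nat | f a i /\ selcount f a i = k]).

Definition independent (R : realType) (F : set binmap)
    (Fs : nat -> set binmap) (a : binseq) : Prop :=
  forall f, F f -> infinite_set [set i : nat | f a i] ->
    predictability R Fs (select f a) = predictability R Fs a.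

Definition summation_axiom (F : set binmap) : Prop :=
  forall f0 f1, F f0 -> F f1 -> F (fun a i => f0 a i (+) f1 a i).

(* The three identities determine f. *)
Definition interleaving_axiom (F : set binmap) : Prop :=
  forall f0 f1 f2, F f0 -> F f1 -> F f2 ->
    exists2 f, F f & forall a,
      [/\ P0 (f a) = P0 (f0 a), P1 (f a) = P1 (f1 a)
        & P2 (f a) = P2 (f2 a)].

Definition subsequences_axiom (F : set binmap) : Prop :=
  forall f, F f ->
    [/\ exists2 f1, F f1 & forall a, P1 (f1 a) = f (S1 a),
        exists2 f2, F f2 & forall a, P1 (f2 a) = f (S2 a),
        exists2 g1, F g1 & forall a, P2 (g1 a) = f (S1 a),
        exists2 g2, F g2 & forall a, P2 (g2 a) = f (S2 a)
      & [/\ exists2 h0, F h0 & forall a, P0 (h0 a) = f (P0 a),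
            exists2 h1, F h1 & forall a, P1 (h1 a) = f (P1 a)
          & exists2 h2, F h2 & forall a, P2 (h2 a) = f (P2 a)]].

Definition switch (f0 f1 f2 : binmap) : binmap :=
  fun a i => if f0 a i then f2 (select f0 a) (selcount f0 a i) else f1 a i.

Definition switching_axiom (F : set binmap) : Prop :=
  forall f0 f1 f2, F f0 -> F f1 -> F f2 -> F (switch f0 f1 f2).

Definition phi (c : bool) : binmap := fun _ _ => c.

(* c0, c1 and c are the fixed values at the initial indices. *)
Definition psi1 (c0 c1 : bool) : binmap :=
  fun a j => match j with 0 => c0 | 1 => c1 | j'.+2 => a j' end.
Definition psi2 (c : bool) : binmap :=
  fun a j => match j with 0 => c | j'.+1 => a j' end.

(* Main.v *)
Require Import Defs.
From mathcomp Require Import all_boot all_order all_algebra.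
From mathcomp Require Import all_classical all_reals all_analysis.
From mathcomp Require Import zify ring lra.

Import Order.TTheory GRing.Theory Num.Theory.
Import numFieldNormedType.Exports.
Local Open Scope classical_set_scope.
Local Open Scope ring_scope.

(** Write p for the predictability of a, and split a into blocks
    (x, y, z) = (a_(3j), a_(3j+1), a_(3j+2)).  Let f1 and f2 be good predictors
    of x + z (the sequence S1 a) and of y + z (the sequence S2 a), and let u, v
    be their error bits on a block (sums modulo 2).

    Then x + f1 and y + f2 are two predictions of z, with errors u and v.
    Since u + v = (x + f1) + (y + f2), whether they disagree is known as soon
    as x and y are, i.e. before z.  Moreover u + v is also the error made when
    y is predicted by x + f1 + f2.  As the terms y of a are as hard to predict
    as a itself, the number d of blocks with u <> v among the first k is at
    least about p k.  Selecting the terms z of the other k - d blocks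
    gives again a sequence which is as hard as a, so x + f1 errs on about
    p (k - d) of them at least; there f2 errs simultaneously.  Counting errors
    by kind of block, f1 and f2 together make at least
      2 p (k - d) + d = 2 p k + (1 - 2 p) d >= (2 p + p (1 - 2 p)) k
    errors, so that I(S1 a) + I(S2 a) >= 2 p + p (1 - 2 p)
    ([predictability_S1_S2]).  One of the two is at least
    p (1 + (1 - 2 p) / 2), and so a fortiori at least p (1 + (1 - 2 p) / 5).

    Predictability being a limsup, the two lower bounds must be made to hold
    at one and the same time n.  This is what [errs_on_lower] achieves: at any
    large time n at which a itself looks hard to sufficiently many predictors
    ([hard_time]), every selected subsequence looks hard too.  Indeed the terms
    which are not selected are, by independence, predicted at every large time
    with error rate about p at most; a good predictor of the selected terms
    would combine with those, by switching, into a predictor of a with error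
    rate below p at time n. *)

(** * Counting errors *)

Definition errs (f : binmap) (a : binseq) (n : nat) : nat :=
  (\sum_(i < n) (f a i (+) a i))%N.

(** Errors of f at the times selected by g. *)
Definition errs_on (g f : binmap) (a : binseq) (n : nat) : nat :=
  (\sum_(i < n) (g a i && (f a i (+) a i)))%N.

Definition compl (g : binmap) : binmap := fun a i => ~~ g a i.

Lemma errs_le (f : binmap) (a : binseq) (n : nat) : (errs f a n <= n)%N.
Proof.
rewrite /errs; elim: n => [|n IH]; first by rewrite big_ord0.
by rewrite big_ord_recr /= -addn1 leq_add//; case: (_ (+) _).
Qed.

Lemma error_rateE (R : realType) (f : binmap) (a : binseq) (n : nat) :
  error_rate R f a n = n%:R^-1 * (errs f a n)%:R.
Proof. by rewrite /error_rate /errs natr_sum. Qed.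

Lemma error_rate_ge0 (R : realType) (f : binmap) (a : binseq) (n : nat) :
  0 <= error_rate R f a n.
Proof. by rewrite error_rateE mulr_ge0 ?invr_ge0. Qed.

Lemma error_rate_le1 (R : realType) (f : binmap) (a : binseq) (n : nat) :
  error_rate R f a n <= 1.
Proof.
rewrite error_rateE; case: n => [|n]; first by rewrite invr0 mul0r.
by rewrite mulrC ler_pdivrMr ?ltr0Sn// mul1r ler_nat errs_le.
Qed.

Lemma errs_error_rate (R : realType) (f : binmap) (a : binseq) (n : nat) :
  (errs f a n)%:R = error_rate R f a n * n%:R :> R.
Proof.
rewrite error_rateE; case: n => [|n]; first by rewrite /errs big_ord0 mulr0.
by rewrite mulrAC mulVf ?mul1r// pnatr_eq0.
Qed.

(** * Predictability in terms of error counts *)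

Lemma min_error_rate_le (R : realType) (G : set binmap) (a : binseq)
  (n : nat) (f : binmap) : G f -> min_error_rate R G a n <= error_rate R f a n.
Proof.
move=> Gf; apply: ge_inf; last by exists f.
by exists 0 => _ [h _ <-]; exact: error_rate_ge0.
Qed.

Lemma min_error_rate01 (R : realType) (G : set binmap) (a : binseq)
  (n : nat) : G !=set0 -> 0 <= min_error_rate R G a n <= 1.
Proof.
move=> [f Gf]; apply/andP; split; last first.
  exact: le_trans (min_error_rate_le _ _ _ _ _ Gf) (error_rate_le1 R f a n).
apply: lb_le_inf; first by exists (error_rate R f a n), f.
by move=> _ [h _ <-]; exact: error_rate_ge0.
Qed.

Lemma min_error_rate_subset (R : realType) (G H : set binmap) (a : binseq)
  (n : nat) : G !=set0 -> G `<=` H ->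
  min_error_rate R H a n <= min_error_rate R G a n.
Proof.
move=> [f Gf] GH; apply: lb_le_inf; first by exists (error_rate R f a n), f.
by move=> _ [h /GH Hh <-]; exact: min_error_rate_le.
Qed.

Lemma sups_ge (R : realType) (u : nat -> R) (m n : nat) :
  (forall k, 0 <= u k <= 1) -> (m <= n)%N -> u n <= sups u m.
Proof.
move=> u01 mn; apply: ub_le_sup; last by exists n.
by exists 1 => _ [k _ <-]; have /andP[] := u01 k.
Qed.

Lemma cvgn_sups01 (R : realType) (u : nat -> R) :
  (forall k, 0 <= u k <= 1) -> nonincreasing_seq (sups u) /\ cvgn (sups u).
Proof.
move=> u01; have dec : nonincreasing_seq (sups u).
  apply: nonincreasing_sups.
  by exists 1 => _ [k _ <-]; have /andP[] := u01 k.
split=> //; apply: nonincreasing_is_cvgn => //.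
exists 0 => _ [k _ <-]; apply: le_trans (sups_ge _ u k k u01 (leqnn k)).
by have /andP[] := u01 k.
Qed.

Lemma limn_sup_lt_eventually (R : realType) (u : nat -> R) (q : R) :
  (forall k, 0 <= u k <= 1) -> limn_sup u < q ->
  exists N, forall n, (N <= n)%N -> u n < q.
Proof.
move=> u01; have [dec cvu] := cvgn_sups01 _ _ u01 => uq.
have [N supNq] : exists N, sups u N < q.
  apply: contrapT => /forallNP nlt; move: uq; rewrite ltNge => /negP; apply.
  by apply: limr_ge => //; apply: nearW => N; rewrite leNgt; exact/negP/nlt.
by exists N => n Nn; apply: le_lt_trans supNq; exact: sups_ge.
Qed.

Lemma limn_sup_gt_frequently (R : realType) (u : nat -> R) (q : R) :
  (forall k, 0 <= u k <= 1) -> q < limn_sup u ->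
  forall N, exists2 n, (N <= n)%N & q < u n.
Proof.
move=> u01; have [dec cvu] := cvgn_sups01 _ _ u01 => uq N.
have : q < sups u N by apply: lt_le_trans uq _; exact: nonincreasing_cvgn_ge.
move/sup_gt; case; first by exists (u N), N => //=.
by move=> _ [n Nn <-] ?; exists n.
Qed.

Lemma limn_sup_le (R : realType) (u v : nat -> R) :
  (forall k, 0 <= u k <= 1) -> (forall k, 0 <= v k <= 1) ->
  (forall k, u k <= v k) -> limn_sup u <= limn_sup v.
Proof.
move=> u01 v01 uv; rewrite leNgt; apply/negP => vu.
have [N ltN] := limn_sup_lt_eventually _ _ _ v01 vu.
have [dec cvu] := cvgn_sups01 _ _ u01.
have [dev cvv] := cvgn_sups01 _ _ v01.
move: vu; rewrite ltNge => /negP; apply.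
apply: ler_lim => //; apply: nearW => n; apply: ge_sup.
  by exists (u n), n => //=.
by move=> _ [k nk <-]; apply: le_trans (uv k) _; exact: sups_ge.
Qed.

Lemma hierarchy_mono (F : set binmap) (Fs : nat -> set binmap) :
  hierarchy F Fs -> forall m n, (m <= n)%N -> Fs m `<=` Fs n.
Proof.
case=> _ _ inc _ m n /subnK <-; elim: (n - m)%N => [//|k IH].
by rewrite addSn; exact: subset_trans IH (inc _).
Qed.

Lemma limn_sup_min_error_rate (R : realType) (F : set binmap)
  (Fs : nat -> set binmap) (s : binseq) : hierarchy F Fs ->
  let L m := limn_sup (min_error_rate R (Fs m) s) in
  nonincreasing_seq L /\ cvgn L.
Proof.
move=> hF L; have [_ ne _ _] := hF.
have r01 m k := min_error_rate01 R _ s k (ne m).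
have dec : nonincreasing_seq L.
  move=> m n mn; apply: limn_sup_le => // k.
  by apply: min_error_rate_subset => //; exact: hierarchy_mono hF _ _ mn.
split=> //; apply: nonincreasing_is_cvgn => //; exists 0 => _ [m _ <-].
have [_ cv] := cvgn_sups01 _ _ (r01 m).
apply: limr_ge => //; apply: nearW => k.
apply: le_trans (sups_ge _ _ k k (r01 m) (leqnn k)).
by have /andP[] := r01 m k.
Qed.

(** The predictor that does well may vary with n, but it can always be taken in
    one level of the hierarchy.  The same index N bounds the level and the
    time, which keeps later statements monotone in a single parameter. *)
Lemma predictability_lt (R : realType) (F : set binmap)
  (Fs : nat -> set binmap) (s : binseq) (q : R) :
  hierarchy F Fs -> predictability R Fs s < q ->
  exists N, forall n, (N <= n)%N ->
    exists2 f, Fs N f & (errs f s n)%:R <= q * n%:R.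
Proof.
move=> hF; have [dec cv] := limn_sup_min_error_rate R _ _ s hF => Iq.
have [_ ne _ _] := hF.
have r01 m k := min_error_rate01 R _ s k (ne m).
have [m mq] : exists m, limn_sup (min_error_rate R (Fs m) s) < q.
  apply: contrapT => /forallNP nlt; move: Iq; rewrite ltNge => /negP; apply.
  by apply: limr_ge => //; apply: nearW => N; rewrite leNgt; exact/negP/nlt.
have [n0 n0q] := limn_sup_lt_eventually _ _ _ (r01 m) mq.
exists (maxn m n0) => n; rewrite geq_max => /andP[mn /n0q].
move/inf_lt; case; first by have [f Ff] := ne m; exists (error_rate R f s n), f.
move=> _ [f Ff <-] ltq; exists f.
  exact: hierarchy_mono hF _ _ (leq_maxl _ _) _ Ff.
by rewrite errs_error_rate ler_wpM2r// ltW.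
Qed.

(** Levels of the hierarchy only add predictors, so every level has a limsup of
    at least the limit; hence one time n defeats a whole level at once. *)
Lemma predictability_gt (R : realType) (F : set binmap)
  (Fs : nat -> set binmap) (s : binseq) (q : R) :
  hierarchy F Fs -> q < predictability R Fs s ->
  forall N, exists2 n, (N <= n)%N &
    forall f, Fs N f -> q * n%:R <= (errs f s n)%:R.
Proof.
move=> hF; have [dec cv] := limn_sup_min_error_rate R _ _ s hF => qI N.
have [_ ne _ _] := hF.
have r01 m k := min_error_rate01 R _ s k (ne m).
have /(limn_sup_gt_frequently _ _ _ (r01 N))/(_ N)[n Nn qn] :
    q < limn_sup (min_error_rate R (Fs N) s).
  by apply: lt_le_trans qI _; exact: (nonincreasing_cvgn_ge dec cv).
exists n => // f Ff; rewrite errs_error_rate ler_wpM2r//.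
exact: le_trans (ltW qn) (min_error_rate_le _ _ _ _ _ Ff).
Qed.

Lemma predictability_ge0 (R : realType) (F : set binmap)
  (Fs : nat -> set binmap) (s : binseq) :
  hierarchy F Fs -> 0 <= predictability R Fs s.
Proof.
move=> hF; rewrite leNgt; apply/negP => I0.
have [|N HN] := predictability_lt _ _ _ s (predictability R Fs s / 2) hF.
  by lra.
have [f _] := HN N.+1 (leqnSn _).
have : (0 : R) < N.+1%:R by rewrite ltr0Sn.
have : (0 : R) <= (errs f s N.+1)%:R by rewrite ler0n.
by nra.
Qed.

Lemma errs_phi (s : binseq) (n : nat) :
  (errs (phi false) s n + errs (phi true) s n)%N = n.
Proof.
rewrite /errs -big_split /=; transitivity (\sum_(i < n) 1)%N.
  by apply: eq_bigr => i _; rewrite /phi; case: (s i).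
by rewrite sum_nat_const card_ord muln1.
Qed.

(** At each step exactly one of the two constant predictors is wrong. *)
Lemma predictability_le_half (R : realType) (F : set binmap)
  (Fs : nat -> set binmap) (s : binseq) :
  hierarchy F Fs -> F (phi false) -> F (phi true) ->
  predictability R Fs s <= 1 / 2.
Proof.
move=> hF F0 F1; rewrite leNgt; apply/negP => I2.
have [_ _ _ FE] := hF.
have [m0 _ Fm0] : (\bigcup_m Fs m) (phi false) by rewrite FE.
have [m1 _ Fm1] : (\bigcup_m Fs m) (phi true) by rewrite FE.
pose q := (1 / 2 + predictability R Fs s) / 2.
have qI : q < predictability R Fs s by rewrite /q; lra.
have [n Nn Hn] := predictability_gt _ _ _ s _ hF qI (maxn m0 m1).+1.
have mono := hierarchy_mono _ _ hF.
have e0 := Hn _ (mono _ _ (leqW (leq_maxl m0 m1)) _ Fm0).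
have e1 := Hn _ (mono _ _ (leqW (leq_maxr m0 m1)) _ Fm1).
have n0 : (0 : R) < n%:R by rewrite ltr0n; exact: leq_ltn_trans Nn.
have := errs_phi s n => /(congr1 (fun k => k%:R : R)); rewrite natrD.
have : 1 / 2 < q by rewrite /q; lra.
by nra.
Qed.

(** * Selected subsequences and switching *)

Lemma selcountS (g : binmap) (a : binseq) (n : nat) :
  selcount g a n.+1 = (selcount g a n + g a n)%N.
Proof. by rewrite /selcount big_ord_recr. Qed.

Lemma selcount_le (g : binmap) (a : binseq) (m n : nat) :
  (m <= n)%N -> (selcount g a m <= selcount g a n)%N.
Proof.
move=> /subnK <-; elim: (n - m)%N => [//|k IH].
by rewrite addSn selcountS (leq_trans IH)// leq_addr.
Qed.

Lemma select_selcount (g : binmap) (a : binseq) (n : nat) :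
  g a n -> select g a (selcount g a n) = a n.
Proof.
move=> gn; rewrite /select; congr (a _); apply: get_unique => // m [gm mn].
have step i j : g a i -> (i < j)%N -> (selcount g a i < selcount g a j)%N.
  move=> gi /(selcount_le g a); apply: leq_trans.
  by rewrite selcountS gi addn1.
have [|lt|//] := ltngtP m n => [lt|].
  by have := step _ _ gm lt; rewrite mn ltnn.
by have := step _ _ gn lt; rewrite mn ltnn.
Qed.

(** Reindexing from the internal time of the subsequence to the time of a. *)
Lemma errs_select (f g : binmap) (a : binseq) (n : nat) :
  errs f (select g a) (selcount g a n) =
  (\sum_(i < n) (g a i && (f (select g a) (selcount g a i) (+) a i)))%N.
Proof.
elim: n => [|n IH]; first by rewrite /errs /selcount !big_ord0.
rewrite big_ord_recr /= -IH selcountS; case gn: (g a n); last by rewrite !addn0.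
by rewrite addn1 /errs big_ord_recr /= select_selcount.
Qed.

(** Switching on the complement of g uses f at the times selected by g and h on
    the subsequence of the other terms. *)
Lemma errs_switch (g f h : binmap) (a : binseq) (n : nat) :
  errs (switch (compl g) f h) a n =
  (errs_on g f a n + errs h (select (compl g) a) (selcount (compl g) a n))%N.
Proof.
rewrite errs_select /errs /errs_on -big_split /=; apply: eq_bigr => i _.
by rewrite /switch /compl; case: (g a i); rewrite ?addn0.
Qed.

Lemma selcount_compl (g : binmap) (a : binseq) (n : nat) :
  (selcount g a n + selcount (compl g) a n)%N = n.
Proof.
rewrite /selcount -big_split /=; transitivity (\sum_(i < n) 1)%N.
  by apply: eq_bigr => i _; rewrite /compl; case: (g a i).
by rewrite sum_nat_const card_ord muln1.
Qed.

Lemma selcount_finite (g : binmap) (a : binseq) :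
  finite_set [set i | g a i] -> exists N, forall n, (selcount g a n <= N)%N.
Proof.
move=> fin; have [N HN] : exists N, forall i, g a i -> (i < N)%N.
  have /finite_seqP[s sE] := fin.
  exists (\max_(i <- s) i).+1 => i gi; rewrite ltnS; apply: leq_bigmax_seq => //.
  by have : [set` s] i by rewrite -sE.
exists (selcount g a N) => n; have [/selcount_le//|] := leqP n N.
move/ltnW/subnK <-; elim: (n - N)%N => [//|k IH].
rewrite addSn selcountS; case E : (g a _); last by rewrite addn0.
by have := HN _ E; rewrite ltnNge leq_addl.
Qed.

(** Independence bounds the errors on the subsequence when its internal time is
    large.  The slack e n absorbs the remaining case of few selected terms,
    which also covers selections that stop after finitely many terms. *)
Lemma select_upper (R : realType) (F : set binmap) (Fs : nat -> set binmap)
  (a : binseq) (g : binmap) (e : R) :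
  hierarchy F Fs -> independent R F Fs a -> F g -> 0 < e ->
  exists N, forall n, (N <= n)%N -> exists2 f, Fs N f &
    (errs f (select g a) (selcount g a n))%:R <=
      predictability R Fs a * (selcount g a n)%:R + e * n%:R.
Proof.
move=> hF ind Fg e0; set p := predictability R Fs a.
have p0 : 0 <= p by exact: predictability_ge0 hF.
have [_ ne _ _] := hF.
have [M HM] : exists M, forall n, (exists2 f, Fs M f &
    (errs f (select g a) (selcount g a n))%:R <=
      (p + e) * (selcount g a n)%:R) \/ (selcount g a n <= M)%N.
  have [fin|inf] := pselect (finite_set [set i | g a i]).
    by have [M HM] := selcount_finite _ _ fin; exists M => n; right.
  have pe : predictability R Fs (select g a) < p + e.
    by rewrite (ind _ Fg inf) ltrDl.
  have [M HM] := predictability_lt _ _ _ _ _ hF pe.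
  exists M => n; have [/HM|/ltnW] := leqP M (selcount g a n); first by left.
  by right.
have ln n : ((selcount g a n)%:R : R) <= n%:R.
  by rewrite ler_nat -[leqRHS](selcount_compl g a) leq_addr.
pose K := (Num.bound (M%:R / e)).
have MK : M%:R <= e * K%:R.
  rewrite mulrC -ler_pdivrMr//; apply/ltW.
  by apply: archi_boundP; rewrite divr_ge0// ltW.
exists (maxn M K) => n; rewrite geq_max => /andP[Mn Kn].
have [[f Ff ef]|lM] := HM n.
  exists f; first exact: hierarchy_mono hF _ _ (leq_maxl _ _) _ Ff.
  by apply: le_trans ef _; have := ln n; nra.
have [f Ff] := ne (maxn M K); exists f => //.
have h1 : ((errs f (select g a) (selcount g a n))%:R : R) <= M%:R.
  by rewrite ler_nat (leq_trans (errs_le _ _ _)).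
have h2 : (K%:R : R) <= n%:R by rewrite ler_nat.
have h3 : 0 <= p * (selcount g a n)%:R by rewrite mulr_ge0.
by nra.
Qed.

(** * Times at which the sequence is hard to predict *)

Lemma finite_set_uniform (T : eqType) (A : set T) (P : T -> nat -> Prop) :
  finite_set A -> (forall x m n, (m <= n)%N -> P x m -> P x n) ->
  (forall x, A x -> exists n, P x n) -> exists n, forall x, A x -> P x n.
Proof.
move=> /finite_seqP[s ->] mono; elim: s => [|x s IH] ex; first by exists 0%N.
have [m Pm] := ex x (mem_head _ _).
have [y /= ys|n Pn] := IH; first by apply: ex; rewrite /= inE ys orbT.
exists (maxn m n) => y /=; rewrite inE => /predU1P[->|ys].
  exact: mono (leq_maxl _ _) Pm.
exact: mono (leq_maxr _ _) (Pn _ ys).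
Qed.

(** The predictability of a is a limsup, so its value is only approached at
    certain times: those n at which no predictor of level N has error rate
    below the predictability by more than e. *)
Definition hard_time (R : realType) (Fs : nat -> set binmap) (a : binseq)
    (e : R) (N n : nat) : Prop :=
  forall f, Fs N f ->
    (predictability R Fs a - e) * n%:R <= (errs f a n)%:R.

Lemma hard_time_le (R : realType) (F : set binmap) (Fs : nat -> set binmap)
  (a : binseq) (e : R) (M N n : nat) :
  hierarchy F Fs -> (M <= N)%N ->
  hard_time R Fs a e N n -> hard_time R Fs a e M n.
Proof. by move=> hF MN h f Ff; apply: h; exact: hierarchy_mono hF _ _ MN _ Ff. Qed.

Lemma errsD (f : binmap) (a : binseq) (m n : nat) :
  (errs f a (m + n) <= errs f a m + n)%N.
Proof.
elim: n => [|n IH]; first by rewrite !addn0.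
rewrite addnS /errs big_ord_recr /= -/(errs f a (m + n)) addnS -addn1.
by apply: leq_add => //; case: (_ (+) _).
Qed.

(** Rounding a hard time down to a multiple of 3 costs at most two errors, which
    are absorbed because one starts from a time that is hard with slack e / 2. *)
Lemma hard_time_mul3 (R : realType) (F : set binmap) (Fs : nat -> set binmap)
  (a : binseq) (e : R) (N : nat) :
  hierarchy F Fs -> 0 < e ->
  exists2 k, (N < k)%N & hard_time R Fs a e N (3 * k).
Proof.
move=> hF e0; set p := predictability R Fs a.
have p0 : 0 <= p by exact: predictability_ge0 hF.
(* k >= K ensures e k > 2 + e, which pays for the at most two lost terms. *)
pose K := Num.bound (2 / e + 1).
have K2 : 2 / e + 1 < K%:R.
  by apply: archi_boundP; rewrite addr_ge0 ?divr_ge0 ?ltW.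
have qp : p - e / 2 < p by lra.
have [n nN Hn] := predictability_gt _ _ _ _ _ hF qp (maxn N (3 * (N + K) + 3)).
have nE := divn_eq n 3; have r3 : (n %% 3 < 3)%N by rewrite ltn_mod.
exists (n %/ 3)%N; first by lia.
move=> f Ff.
have Nn : (N <= maxn N (3 * (N + K) + 3))%N by exact: leq_maxl.
have := Hn f (hierarchy_mono _ _ hF _ _ Nn _ Ff).
set k := (n %/ 3)%N in nE *; set r := (n %% 3)%N in nE r3.
rewrite -/p.
have -> : n = (3 * k + r)%N by lia.
rewrite natrM natrD natrM.
have := errsD f a (3 * k) r; rewrite -(ler_nat R) natrD.
have : (r%:R : R) <= 2 by rewrite ler_nat -ltnS.
have : (0 : R) <= r%:R by [].
have : (K%:R : R) <= k%:R by rewrite ler_nat; lia.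
have : 2 + e < e * K%:R.
  rewrite -(ltr_pM2l e0) in K2; apply: le_lt_trans K2.
  by rewrite mulrDr mulr1 mulrCA divff ?gt_eqF// mulr1.
move: (errs _ _ _)%:R (errs _ _ _)%:R k%:R r%:R K%:R => E1 E2 x y z.
by nra.
Qed.

(** At hard times for a, the terms selected by g are hard as well: a predictor of
    these terms can be completed, by switching, with one that has error rate
    about the predictability of a on the remaining terms, and the resulting
    predictor cannot do better than a allows. *)
Lemma errs_on_lower (R : realType) (F : set binmap) (Fs : nat -> set binmap)
  (a : binseq) (g f : binmap) (e : R) :
  hierarchy F Fs -> summation_axiom F -> switching_axiom F ->
  F (phi true) -> independent R F Fs a -> F g -> F f -> 0 < e ->
  exists N, forall n, (N <= n)%N -> hard_time R Fs a e N n ->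
    predictability R Fs a * (selcount g a n)%:R - 2 * e * n%:R <=
      (errs_on g f a n)%:R.
Proof.
move=> hF Fsum Fsw F1 ind Fg Ff e0; set p := predictability R Fs a.
have Fc : F (compl g).
  have -> : compl g = (fun a i => g a i (+) phi true a i).
    by apply/funext => s; apply/funext => i; rewrite /compl /phi addbT.
  exact: Fsum.
have [N1 HN1] := select_upper _ _ _ _ _ _ hF ind Fc e0.
have [finF _ _ FE] := hF.
have [m Hm] : exists m, forall h, Fs N1 h -> Fs m (switch (compl g) f h).
  apply: finite_set_uniform => //.
    by move=> h m n mn; exact: hierarchy_mono hF _ _ mn _.
  move=> h Fh; have : F (switch (compl g) f h).
    by apply: Fsw => //; rewrite -FE; exists N1.
  by rewrite -FE => -[m _ Fm]; exists m.
(* Level m contains all the combined predictors, whatever good predictor h of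
   the complementary terms is needed at time n. *)
exists (maxn m N1) => n; rewrite geq_max => /andP[mn Nn] hard.
have [h Fh eh] := HN1 n Nn.
have := hard _ (hierarchy_mono _ _ hF _ _ (leq_maxl _ _) _ (Hm h Fh)).
rewrite errs_switch natrD.
have := selcount_compl g a n => /(congr1 (fun k => k%:R : R)).
move=> /(congr1 ( *%R p)); rewrite natrD mulrDr -/p; move: eh; rewrite -/p.
lra.
Qed.

(** * The two predictors on blocks of length three *)

Lemma sum_mul3 (G : nat -> nat) (k : nat) :
  (\sum_(i < 3 * k) G i =
   \sum_(j < k) (G (3 * j) + G (3 * j + 2) + G (3 * j + 1)))%N.
Proof.
elim: k => [|k IH]; first by rewrite muln0 !big_ord0.
rewrite mulnS addnC addn3 !big_ord_recr /= IH addn1 addn2.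
by rewrite -!addnA [(G _.+1 + _)%N]addnC.
Qed.

(** At the middle term y of each block, x + f1 + f2 is a prediction of y; it fails
    exactly when one, and only one, of f1 and f2 fails on the block. *)
Lemma predictors_middle (F : set binmap) (c : bool) (f1 f2 : binmap) :
  summation_axiom F -> interleaving_axiom F -> subsequences_axiom F ->
  F (phi false) -> F (phi true) -> F (psi2 c) -> F f1 -> F f2 ->
  exists g f, [/\ F g, F f & forall a k,
    selcount g a (3 * k) = k /\
    errs_on g f a (3 * k) =
      (\sum_(j < k) ((f1 (S1 a) j (+) S1 a j) (+) (f2 (S2 a) j (+) S2 a j)))%N].
Proof.
move=> Fsum Fint Fsub F0 F1 Fpsi Ff1 Ff2.
have [g Fg gE] := Fint _ _ _ F0 F0 F1.
have [_ _ [g1 Fg1 g1E] _ _] := Fsub _ Ff1.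
have [_ _ _ [g2 Fg2 g2E] _] := Fsub _ Ff2.
exists g, (fun a i => (g1 a i (+) g2 a i) (+) psi2 c a i).
split=> //; first exact: (Fsum _ _ (Fsum _ _ Fg1 Fg2) Fpsi).
move=> a k; have [e0 e1 e2] := gE a.
have g0j j : g a (3 * j)%N = false := congr1 (@^~ j) e0.
have g1j j : g a (3 * j + 2)%N = false := congr1 (@^~ j) e1.
have g2j j : g a (3 * j + 1)%N = true := congr1 (@^~ j) e2.
split.
  rewrite /selcount (sum_mul3 (fun i => g a i : nat)).
  under eq_bigr do rewrite g0j g1j g2j.
  by rewrite sum_nat_const card_ord muln1.
rewrite /errs_on
  (sum_mul3 (fun i => g a i && (((g1 a i (+) g2 a i) (+) psi2 c a i) (+) a i))).
apply: eq_bigr => j _; rewrite g0j g1j g2j /=.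
have -> : g1 a (3 * j + 1)%N = f1 (S1 a) j := congr1 (@^~ (j : nat)) (g1E a).
have -> : g2 a (3 * j + 1)%N = f2 (S2 a) j := congr1 (@^~ (j : nat)) (g2E a).
rewrite /S1 /S2 !add0n; congr nat_of_bool.
have -> : (3 * j + 1)%N = (3 * j).+1 by rewrite addn1.
rewrite /psi2 /=; case: (f1 _ _); case: (f2 _ _); case: (a (3 * j)%N);
  by case: (a (3 * j).+1); case: (a (3 * j + 2)%N).
Qed.

(** At the last term z of a block, x + f1 and y + f2 are predictions of z; g
    selects the blocks where they agree, and there x + f1 fails exactly when
    both f1 and f2 do. *)
Lemma predictors_last (F : set binmap) (c0 c1 c : bool) (f1 f2 : binmap) :
  summation_axiom F -> interleaving_axiom F -> subsequences_axiom F ->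
  F (phi false) -> F (phi true) -> F (psi1 c0 c1) -> F (psi2 c) ->
  F f1 -> F f2 ->
  exists g f, [/\ F g, F f & forall a k,
    let u j := f1 (S1 a) j (+) S1 a j in
    let v j := f2 (S2 a) j (+) S2 a j in
    selcount g a (3 * k) = (\sum_(j < k) ~~ (u j (+) v j))%N /\
    errs_on g f a (3 * k) = (\sum_(j < k) (~~ (u j (+) v j) && u j))%N].
Proof.
move=> Fsum Fint Fsub F0 F1 Fpsi1 Fpsi2 Ff1 Ff2.
have [[h1 Fh1 h1E] _ _ _ _] := Fsub _ Ff1.
have [_ [h2 Fh2 h2E] _ _ _] := Fsub _ Ff2.
have Fu := Fsum _ _ Fh1 Fpsi1; have Fv := Fsum _ _ Fh2 Fpsi2.
have [g Fg gE] := Fint _ _ _ F0 (Fsum _ _ (Fsum _ _ Fu Fv) F1) F0.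
eexists g, _; split; [exact: Fg | exact: Fu | move=> a k u v].
have h1j j : h1 a (3 * j + 2)%N = f1 (S1 a) j := congr1 (@^~ j) (h1E a).
have h2j j : h2 a (3 * j + 2)%N = f2 (S2 a) j := congr1 (@^~ j) (h2E a).
have [e0 e1 e2] := gE a.
have g0j j : g a (3 * j)%N = false := congr1 (@^~ j) e0.
have g2j j : g a (3 * j + 1)%N = false := congr1 (@^~ j) e2.
have p1j j : psi1 c0 c1 a (3 * j + 2)%N = a (3 * j)%N by rewrite addn2.
have p2j j : psi2 c a (3 * j + 2)%N = a (3 * j + 1)%N by rewrite addn2 addn1.
have g1j j : g a (3 * j + 2)%N = ~~ (u j (+) v j).
  rewrite [LHS](congr1 (@^~ j) e1 : _ = P1 _ j) /P1 h1j h2j p1j p2j /u /v.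
  rewrite /S1 /S2 /phi; case: (f1 _ _); case: (f2 _ _); case: (a (3 * j)%N);
  by case: (a (3 * j + 1)%N); case: (a (3 * j + 2)%N).
split.
  rewrite /selcount (sum_mul3 (fun i => g a i : nat)).
  by under eq_bigr do rewrite g0j g1j g2j addn0.
rewrite /errs_on
  (sum_mul3 (fun i => g a i && ((h1 a i (+) psi1 c0 c1 a i) (+) a i))).
apply: eq_bigr => j _; rewrite g0j g1j g2j /= addn0 add0n h1j p1j.
by rewrite -addbA.
Qed.

(** * Amplification *)

(** Blocks on which both predictors fail count twice, those on which exactly
    one fails count once. *)
Lemma double_count (k : nat) (u v : nat -> bool) :
  (\sum_(j < k) u j + \sum_(j < k) v j =
   2 * (\sum_(j < k) (~~ (u j (+) v j) && u j)) + \sum_(j < k) (u j (+) v j))%N.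
Proof.
by rewrite big_distrr /= -!big_split /=; apply: eq_bigr => j _;
  case: (u j); case: (v j).
Qed.

Lemma sum_negb (k : nat) (d : nat -> bool) :
  (\sum_(j < k) d j + \sum_(j < k) ~~ d j = k)%N.
Proof.
exact: (selcount_compl (fun _ => d) d k).
Qed.

(** Here k is the number of blocks, d and d' are the numbers of blocks where the
    two predictions of z disagree and agree, w counts joint failures, and the
    number of terms is 3 k.  The bound on w is used with d' = k - d; the
    coefficient of d in the result is then 1 - 2 p >= 0, so that the lower
    bound on d applies. *)
Lemma amplification_bound (R : realFieldType) (p e k d d' w : R) :
  0 <= p <= 1 / 2 -> 0 <= e -> 0 <= k -> d + d' = k ->
  p * d' - 2 * e * (3 * k) <= w -> p * k - 2 * e * (3 * k) <= d ->
  (2 * p + p * (1 - 2 * p) - 18 * e) * k <= 2 * w + d.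
Proof.
move=> /andP[p0 p2] e0 k0 dk hw hd.
have h1 : 0 <= (d - p * k + 6 * e * k) * (1 - 2 * p) by apply: mulr_ge0; lra.
have h2 : 0 <= p * (e * k) by rewrite mulr_ge0// mulr_ge0.
have d'E : d' = k - d by lra.
rewrite {}d'E in hw dk; move: h1 h2 hw; rewrite !mulrBr !mulrBl => h1 h2 hw.
lra.
Qed.

(** The best predictors f1, f2 depend on the time k, whereas the lower bounds
    on errors hold from a time and a level on that depend on f1, f2.  Since k
    is chosen last, this threshold is first made uniform over the finitely many
    pairs that can occur. *)
Lemma predictability_S1_S2 (R : realType) (F : set binmap)
    (Fs : nat -> set binmap) (c0 c1 c : bool) (a : binseq) :
  summation_axiom F -> interleaving_axiom F -> subsequences_axiom F ->
  switching_axiom F -> F (phi false) -> F (phi true) ->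
  F (psi1 c0 c1) -> F (psi2 c) -> hierarchy F Fs -> independent R F Fs a ->
  2 * predictability R Fs a +
    predictability R Fs a * (1 - 2 * predictability R Fs a) <=
    predictability R Fs (S1 a) + predictability R Fs (S2 a).
Proof.
set I := predictability R Fs.
move=> Fsum Fint Fsub Fsw F0 F1 Fpsi1 Fpsi2 hF ind.
rewrite leNgt; apply/negP => lt; set p := I a in lt.
have p0 : 0 <= p by exact: predictability_ge0 hF.
have p2 : p <= 1 / 2 by exact: predictability_le_half hF F0 F1.
(* The lower bounds lose 18 e and the choice of f1 and f2 loses 2 e: a gap of
   21 e between the two sides leaves a contradiction. *)
pose e := (2 * p + p * (1 - 2 * p) - (I (S1 a) + I (S2 a))) / 21.
have e0 : 0 < e by rewrite divr_gt0// subr_gt0.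
have [N1 HN1] : exists N, forall n, (N <= n)%N ->
    exists2 f, Fs N f & (errs f (S1 a) n)%:R <= (I (S1 a) + e) * n%:R.
  by apply: predictability_lt hF _; rewrite ltrDl.
have [N2 HN2] : exists N, forall n, (N <= n)%N ->
    exists2 f, Fs N f & (errs f (S2 a) n)%:R <= (I (S2 a) + e) * n%:R.
  by apply: predictability_lt hF _; rewrite ltrDl.
have [finF _ _ FE] := hF.
have FsF m f : Fs m f -> F f by move=> Ff; rewrite -FE; exists m.
pose bound f1 f2 N := forall k, (N <= k)%N -> hard_time R Fs a e N (3 * k) ->
  (2 * p + p * (1 - 2 * p) - 18 * e) * k%:R <=
    (errs f1 (S1 a) k + errs f2 (S2 a) k)%:R.
have [N HN] : exists N, forall f12 : binmap * binmap,
    (Fs N1 `*` Fs N2) f12 -> bound f12.1 f12.2 N.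
  apply: finite_set_uniform; first exact: finite_setX.
    move=> f12 m n mn bm k nk hk; apply: bm; first exact: leq_trans nk.
    exact: hard_time_le hF mn hk.
  move=> [f1 f2] [/= /FsF Ff1 /FsF Ff2].
  have [gy [fy [Fgy Ffy yE]]] :=
    predictors_middle _ _ _ _ Fsum Fint Fsub F0 F1 Fpsi2 Ff1 Ff2.
  have [gz [fz [Fgz Ffz zE]]] :=
    predictors_last _ _ _ _ _ _ Fsum Fint Fsub F0 F1 Fpsi1 Fpsi2 Ff1 Ff2.
  have [My HMy] := errs_on_lower _ _ _ _ _ _ _ hF Fsum Fsw F1 ind Fgy Ffy e0.
  have [Mz HMz] := errs_on_lower _ _ _ _ _ _ _ hF Fsum Fsw F1 ind Fgz Ffz e0.
  exists (maxn My Mz) => k; rewrite geq_max => /andP[yk zk] hk.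
  have k3 M : (M <= k)%N -> (M <= 3 * k)%N by lia.
  have := HMy _ (k3 _ yk) (hard_time_le _ _ _ _ _ _ _ _ hF (leq_maxl _ _) hk).
  have := HMz _ (k3 _ zk) (hard_time_le _ _ _ _ _ _ _ _ hF (leq_maxr _ _) hk).
  have [-> ->] := yE a k; have [-> ->] := zE a k.
  pose u j := f1 (S1 a) j (+) S1 a j; pose v j := f2 (S2 a) j (+) S2 a j.
  rewrite -!/(u _) -!/(v _) /=.
  rewrite [X in _ -> _ -> is_true (_ <= X%:R)](double_count k u v).
  rewrite natrM natrD natrM.
  have := sum_negb k (fun j => u j (+) v j).
  move=> /(congr1 (fun n => n%:R : R)); rewrite natrD -/I -/p.
  set d := (\sum_(_ < _) _)%N%:R; set ee := (\sum_(_ < _) _)%N%:R.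
  set w := (\sum_(_ < _) _)%N%:R => ek hz hy.
  by apply: (@amplification_bound R p e k%:R d ee w) => //;
    [apply/andP | exact: ltW].
have [k Nk hk] := hard_time_mul3 R F Fs a e (maxn N (maxn N1 N2)) hF e0.
move: Nk; rewrite !gtn_max => /and3P[Nk N1k N2k].
have [f1 Ff1 e1] := HN1 k (ltnW N1k); have [f2 Ff2 e2] := HN2 k (ltnW N2k).
have := HN (f1, f2) (conj Ff1 Ff2) k (ltnW Nk)
  (hard_time_le _ _ _ _ _ _ _ _ hF (leq_maxl _ _) hk).
rewrite /= natrD.
have k0 : (0 : R) < k%:R by rewrite ltr0n; exact: leq_ltn_trans Nk.
have -> : 2 * p + p * (1 - 2 * p) - 18 * e = I (S1 a) + I (S2 a) + 3 * e.
  have : 21 * e = 2 * p + p * (1 - 2 * p) - (I (S1 a) + I (S2 a)).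
    by rewrite /e mulrC divfK// pnatr_eq0.
  move: (p * _) => pp; clear; move: (I _) (I _) => x y; lra.
move=> le3; have := le_trans le3 (lerD e1 e2); rewrite -mulrDl ler_pM2r//.
by move: e0; clear; move: (I _) (I _) => x y; lra.
Qed.

(** The factor 1/5 is weaker than the factor 1/2 that averaging provides. *)
Lemma one_side_gain (R : realFieldType) (p x y : R) : 0 <= p <= 1 / 2 ->
  2 * p + p * (1 - 2 * p) <= x + y ->
  p * (1 + (1 - 2 * p) / 5) <= x \/ p * (1 + (1 - 2 * p) / 5) <= y.
Proof.
move=> /andP[p0 p2] le_xy.
have p3 : 0 <= p * (1 - 2 * p) by apply: mulr_ge0 => //; lra.
have [le|/ltW le] := leP x y; [right | left]; lra.
Qed.

Lemma strict_gain (R : realFieldType) (p : R) : 0 < p < 1 / 2 ->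
  p < p * (1 + (1 - 2 * p) / 5).
Proof.
move=> /andP[p0 p2].
have p3 : 0 < p * (1 - 2 * p) by apply: mulr_gt0 => //; lra.
lra.
Qed.

Theorem theorem5p5 (R : realType) (F : set binmap) (Fs : nat -> set binmap)
    (c0 c1 c : bool) (a : binseq) (b : nat -> binseq)
    (F_causal : forall f, F f -> causal f)
    (F_sum : summation_axiom F)
    (F_interleave : interleaving_axiom F)
    (F_subseq : subsequences_axiom F)
    (F_switch : switching_axiom F)
    (F_phi0 : F (phi false)) (F_phi1 : F (phi true))
    (F_psi1 : F (psi1 c0 c1)) (F_psi2 : F (psi2 c))
    (Fs_hierarchy : hierarchy F Fs)
    (a_indep : independent R F Fs a)
    (b_def : forall nu i : nat, (1 <= nu <= 2)%N ->
       b nu i = a (3 * i + nu - 1)%N (+) a (3 * i + 2)%N) :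
  let I := predictability R Fs in
  (exists nu : nat, (1 <= nu <= 2)%N /\
     I (b nu) >= I a * (1 + (1 - 2 * I a) / 5)) /\
  (0 < I a < 1 / 2 -> exists nu : nat, (1 <= nu <= 2)%N /\ I (b nu) > I a).
Proof.
move=> I.
have b1E : b 1%N = S1 a by apply/funext => i; rewrite b_def// addnK.
have b2E : b 2%N = S2 a by apply/funext => i; rewrite b_def// -addnBA.
have p01 : 0 <= I a <= 1 / 2.
  rewrite (predictability_ge0 _ _ _ _ Fs_hierarchy).
  exact: predictability_le_half Fs_hierarchy _ _.
have : 2 * I a + I a * (1 - 2 * I a) <= I (S1 a) + I (S2 a).
  exact: (@predictability_S1_S2 R F Fs c0 c1 c a).
rewrite -b1E -b2E => sum_ge.
have [nu [nu12 Ib]] : exists nu : nat, (1 <= nu <= 2)%N /\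
    I (b nu) >= I a * (1 + (1 - 2 * I a) / 5).
  have [le1|le2] := one_side_gain _ _ _ _ p01 sum_ge.
    by exists 1%N.
  by exists 2%N.
split; first by exists nu.
move=> p_in; exists nu; split=> //; apply: lt_le_trans Ib.
exact: strict_gain.
Qed.
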